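(* Let $G$ be a finite simple connected graph, not isomorphic to $K_2$, with $D'(G)=2$. If $G$ has a non-trivial, non-twisted automorphism, then $OD'^+(G)=2$. Otherwise, $OD'^-(G)=OD'^+(G)=1$.
   Context: An automorphism $\varphi\in\operatorname{Aut}(G)$ is twisted if some positive power of $\varphi$ interchanges the endpoints of an edge of $G$, and non-twisted otherwise. Write $[k]=\{1,\ldots,k\}$. For a graph $G$, an edge colouring $c\colon E(G)\to[k]$ (not necessarily proper) breaks an automorphism $\varphi\in\operatorname{Aut}(G)$ if some edge $xy$ satisfies $c(\varphi(x)\varphi(y))\neq c(xy)$; it is distinguishing if it breaks every non-trivial automorphism of $G$. The distinguishing index $D'(G)$ is the least integer $k\ge 1$ for which $G$ has a distinguishing colouring $E(G)\to[k]$. For a digraph, automorphisms preserve arcs together with their directions, and distinguishing arc colourings and the distinguishing index $D'$ are defined in the same way with arcs in place of edges. An orientation of $G$ is a digraph $\overrightarrow{G}$ obtained from $G$ by replacing each edge $xy$ with exactly one of the arcs $\overrightarrow{xy}$, $\overrightarrow{yx}$. Define $OD'^-(G)=\min D'(\overrightarrow{G})$ and $OD'^+(G)=\max D'(\overrightarrow{G})$, both over all orientations $\overrightarrow{G}$ of $G$. *)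

(* Defs.v *)
From mathcomp Require Import all_boot all_fingroup.

Set Implicit Arguments.
Unset Strict Implicit.
Unset Printing Implicit Defensive.

(* A digraph on T is a relation [e : rel T], with [e x y] read as the arc from
   x to y; a simple graph is a relation that is symmetric and irreflexive. *)

Record simple_graph (T : finType) (e : rel T) : Prop := SimpleGraph {
  simple_graph_sym : symmetric e;
  simple_graph_irr : irreflexive e }.

Definition connected_graph (T : finType) (e : rel T) : Prop :=
  0 < #|T| /\ forall x y : T, connect e x y.

Definition isomorphic (T U : finType) (e : rel T) (e' : rel U) : Prop :=
  exists2 f : T -> U, bijective f & forall x y : T, e' (f x) (f y) = e x y.

Definition K2 : rel bool := fun x y => x != y.

Definition automorphism (T : finType) (e : rel T) (f : {perm T}) : Prop :=
  forall x y : T, e (f x) (f y) = e x y.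

Definition twisted (T : finType) (e : rel T) (f : {perm T}) : Prop :=
  exists n : nat, 0 < n /\
  exists x y : T, [/\ e x y, (f ^+ n)%g x = y & (f ^+ n)%g y = x].

(* The edge xy is the unordered pair [set x; y].  Colourings are total
   functions, but only their values on edges (resp. arcs) are ever used. *)

Definition edge_breaks (T : finType) (e : rel T) (k : nat)
    (c : {set T} -> 'I_k) (f : {perm T}) : Prop :=
  exists x y : T, e x y /\ c [set f x; f y] <> c [set x; y].

Definition edge_distinguishing (T : finType) (e : rel T) (k : nat)
    (c : {set T} -> 'I_k) : Prop :=
  forall f : {perm T}, automorphism e f -> f <> 1%g -> edge_breaks e c f.

Definition arc_breaks (T : finType) (d : rel T) (k : nat)
    (c : T * T -> 'I_k) (f : {perm T}) : Prop :=
  exists x y : T, d x y /\ c (f x, f y) <> c (x, y).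

Definition arc_distinguishing (T : finType) (d : rel T) (k : nat)
    (c : T * T -> 'I_k) : Prop :=
  forall f : {perm T}, automorphism d f -> f <> 1%g -> arc_breaks d c f.

Definition least_pos (P : nat -> Prop) (k : nat) : Prop :=
  [/\ 0 < k, P k & forall j : nat, 0 < j -> P j -> k <= j].

(* The indices D', OD'^- and OD'^+ need not exist (K_2 has no distinguishing
   edge colouring), so they are predicates on k: [dist_index e k] reads
   "D'(G) is defined and equal to k", and similarly for the others. *)

Definition dist_index (T : finType) (e : rel T) : nat -> Prop :=
  least_pos (fun k => exists c : {set T} -> 'I_k, edge_distinguishing e c).

Definition arc_dist_index (T : finType) (d : rel T) : nat -> Prop :=
  least_pos (fun k => exists c : T * T -> 'I_k, arc_distinguishing d c).

Definition orientation (T : finType) (e d : rel T) : Prop :=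
  forall x y : T, (d x y || d y x) = e x y /\ ~~ (d x y && d y x).

(* Both the minimum and the maximum require the index of every orientation to
   be defined. *)

Definition OD_minus (T : finType) (e : rel T) (k : nat) : Prop :=
  (exists2 d : rel T, orientation e d & arc_dist_index d k) /\
  (forall d : rel T, orientation e d ->
     exists2 m : nat, arc_dist_index d m & k <= m).

Definition OD_plus (T : finType) (e : rel T) (k : nat) : Prop :=
  (exists2 d : rel T, orientation e d & arc_dist_index d k) /\
  (forall d : rel T, orientation e d ->
     exists2 m : nat, arc_dist_index d m & m <= k).

(* Main.v *)
Require Import Defs.
From mathcomp Require Import all_boot all_fingroup.

Set Implicit Arguments.
Unset Strict Implicit.
Unset Printing Implicit Defensive.

(** The whole theorem rests on one equivalence: an automorphism of a simple
    graph [G] is an automorphism of some orientation of [G] exactly when it is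
    non-twisted ([orientation_automorphism_not_twisted] and
    [not_twisted_invariant_orientation]).  An orientation preserved by [f] is
    preserved by all powers of [f], and none of these can then reverse an edge;
    conversely, if no power of [f] reverses an edge, then the two arcs carried
    by an edge lie in different orbits of [f], so that one can choose one orbit
    out of each such pair and obtain an orientation preserved by [f].

    A single colour distinguishes a digraph exactly when the digraph has no
    non-trivial automorphism.  Hence a non-trivial non-twisted automorphism
    produces an orientation that needs at least two colours, and without such
    an automorphism every orientation is rigid and needs only one.  Two colours
    always suffice when [D'(G) = 2], because an automorphism of an orientation
    is an automorphism of [G] and an edge colouring can be read on the arcs. *)

Lemma automorphism_expg (T : finType) (d : rel T) (f : {perm T}) n :
  automorphism d f -> automorphism d (f ^+ n)%g.
Proof.
move=> autf; elim: n => [|n IHn] x y; first by rewrite expg0 !perm1.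
by rewrite expgSr !permM autf.
Qed.

Lemma orientation_automorphism (T : finType) (e d : rel T) (f : {perm T}) :
  orientation e d -> automorphism d f -> automorphism e f.
Proof. by move=> ori autf x y; rewrite -!(proj1 (ori _ _)) !autf. Qed.

Lemma orientation_automorphism_not_twisted (T : finType) (e d : rel T)
    (f : {perm T}) :
  orientation e d -> automorphism d f -> ~ twisted e f.
Proof.
move=> ori autf [n [_ [x [y [exy fx fy]]]]].
have [dxy anti] := ori x y.
have dyx : d y x = d x y by rewrite -(automorphism_expg n autf x y) fx fy.
by move: anti dxy; rewrite exy dyx andbb orbb => /negbTE ->.
Qed.

(** The choice between the orbits of [(x, y)] and of [(y, x)] is made by
    comparing their canonical representatives: this is invariant under [f] by
    construction, and total because the two orbits of an edge are distinct. *)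
Lemma not_twisted_invariant_orientation (T : finType) (e : rel T)
    (f : {perm T}) :
  simple_graph e -> automorphism e f -> ~ twisted e f ->
  exists2 d : rel T, orientation e d & automorphism d f.
Proof.
move=> [syme irre] autf ntwf.
pose g (p : T * T) := (f p.1, f p.2).
have injg : injective g by move=> [x y] [u v] [/perm_inj -> /perm_inj ->].
have gsym := fconnect_sym injg.
pose r p := enum_rank (froot g p).
pose d x y := e x y && (r (x, y) < r (y, x)).
have rg p : r (g p) = r p.
  congr enum_rank; apply/eqP.
  by rewrite (root_connect gsym) gsym; apply: fconnect1.
have iterg n x y : iter n g (x, y) = ((f ^+ n)%g x, (f ^+ n)%g y).
  by elim: n => [|n IHn]; rewrite ?expg0 ?perm1 //= IHn expgSr !permM.
have r_neq x y : e x y -> r (x, y) != r (y, x).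
  move=> exy; apply/eqP => /enum_rank_inj/eqP; rewrite (root_connect gsym).
  move=> /iter_findex; set n := findex _ _ _; rewrite iterg => -[fx fy].
  apply: ntwf; exists n; split; last by exists x, y.
  (* The power is a positive one because an edge has distinct ends. *)
  by case: n fx {fy} => // /eqP; rewrite expg0 perm1 => /eqP xy;
     rewrite xy irre in exy.
exists d => [x y | x y]; last first.
  by rewrite /d autf -[(f x, f y)]/(g (x, y)) -[(f y, f x)]/(g (y, x)) !rg.
rewrite /d (syme y x); case exy: (e x y) => //=.
by have := r_neq x y exy; rewrite -val_eqE /=; case: ltngtP.
Qed.

Lemma exists_orientation (T : finType) (e : rel T) :
  simple_graph e -> exists d : rel T, orientation e d.
Proof.
move=> simple_e.
have aut1 : automorphism e 1%g by move=> x y; rewrite !perm1.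
have ntw1 : ~ twisted e 1%g.
  move=> [n [_ [x [y [exy]]]]]; rewrite expg1n perm1 => xy _.
  by rewrite xy (simple_graph_irr simple_e) in exy.
by have [d ori _] := not_twisted_invariant_orientation simple_e aut1 ntw1;
  exists d.
Qed.

Definition rigid (T : finType) (d : rel T) : Prop :=
  forall f : {perm T}, automorphism d f -> f = 1%g.

(** Rigidity is a decidable property of a finite digraph, so that the index of
    a given orientation can be computed by cases. *)
Lemma rigidP (T : finType) (d : rel T) :
  reflect (rigid d)
    [forall f : {perm T}, [forall x, [forall y, d (f x) (f y) == d x y]]
                            ==> (f == 1%g)].
Proof.
apply: (iffP 'forall_implyP) => rig f autf.
  by apply/eqP/rig/forallP => x; apply/forallP => y; rewrite autf.
by apply/eqP/rig => x y; move/forallP/(_ x)/forallP/(_ y)/eqP: autf.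
Qed.

Lemma arc_distinguishing1P (T : finType) (d : rel T) :
  (exists c : T * T -> 'I_1, arc_distinguishing d c) <-> rigid d.
Proof.
split=> [[c dist] f autf | rig]; last first.
  by exists (fun=> ord0) => f /rig ->.
apply/eqP; apply: contraT => /eqP fn1.
by have [x [y [_ []]]] := dist f autf fn1; rewrite !ord1.
Qed.

Lemma rigid_arc_dist_index1 (T : finType) (d : rel T) :
  rigid d -> arc_dist_index d 1.
Proof. by move=> rig; split=> //; apply/arc_distinguishing1P. Qed.

Lemma not_rigid_arc_dist_index2 (T : finType) (d : rel T) :
    ~ rigid d -> (exists c : T * T -> 'I_2, arc_distinguishing d c) ->
  arc_dist_index d 2.
Proof.
by move=> nrig dist2; split=> // -[|[|j]] // _ /arc_distinguishing1P.
Qed.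

Lemma orientation_arc_distinguishing (T : finType) (e d : rel T) k
    (c : {set T} -> 'I_k) :
  orientation e d -> edge_distinguishing e c ->
  arc_distinguishing d (fun p => c [set p.1; p.2]).
Proof.
move=> ori dist f autf fn1.
have [x [y [exy cxy]]] := dist f (orientation_automorphism ori autf) fn1.
move: exy; rewrite -(proj1 (ori x y)) => /orP[dxy | dyx]; first by exists x, y.
by exists y, x; rewrite /= setUC [[set y; x]]setUC.
Qed.

Theorem theorem11 (T : finType) (e : rel T)
    (simple_e : simple_graph e) (connected_e : connected_graph e)
    (not_K2 : ~ isomorphic e K2) (index_e : dist_index e 2) :
  ((exists f : {perm T}, [/\ automorphism e f, f <> 1%g & ~ twisted e f]) ->
     OD_plus e 2) /\
  (~ (exists f : {perm T}, [/\ automorphism e f, f <> 1%g & ~ twisted e f]) ->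
     OD_minus e 1 /\ OD_plus e 1).
Proof.
have [_ [c dist_c] _] := index_e.
have dist2 d : orientation e d ->
    exists c' : T * T -> 'I_2, arc_distinguishing d c'.
  by move=> ori; eexists; apply: orientation_arc_distinguishing ori dist_c.
split=> [[f [autf fn1 ntwf]] | no_f].
  split=> [|d ori].
    have [d ori autdf] := not_twisted_invariant_orientation simple_e autf ntwf.
    exists d => //; apply: not_rigid_arc_dist_index2 (dist2 d ori).
    by move=> /(_ f autdf).
  have [rig | nrig] := rigidP d.
    by exists 1; first exact: rigid_arc_dist_index1.
  by exists 2; first exact: not_rigid_arc_dist_index2 (dist2 d ori).
have index1 d : orientation e d -> arc_dist_index d 1.
  move=> ori; apply: rigid_arc_dist_index1 => f autf.
  apply/eqP; apply: contraT => /eqP fn1; case: no_f; exists f; split=> //.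
    exact: orientation_automorphism ori autf.
  exact: orientation_automorphism_not_twisted ori autf.
have [d0 ori0] := exists_orientation simple_e.
by split; (split=> [|d ori]; [exists d0 | exists 1]); auto.
Qed.
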